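(* Let $(\mathcal{H},g)$ be a Hilbert space with inner product $g$. Let $H:\mathcal{H}\to\mathcal{H}$ be a bounded linear operator with closed range, not necessarily invertible, and let $b\in\mathcal{R}(H)$. Let $\hat V:=H^+b$, the minimum norm solution of the equation $HV=b$, where $H^+$ is the Moore-Penrose pseudoinverse of $H$. Then $\hat V$ is also the unique solution of the optimization problem $$\min_{V\in\mathcal{H}}\ g(V,V)\qquad\text{s.t. } HV=b.$$ Furthermore, if $H$ is self-adjoint in the scalar product $g$ and positive semidefinite, then $\hat V$ can be computed as the limit of the solutions $V_\varepsilon$ of the following family of linear-quadratic problems parameterized by $\varepsilon>0$: for $$V_\varepsilon:=\arg\min_{V\in\mathcal{H}}\ \frac12 g(HV,V)-g(b,V)+\frac{\varepsilon}{2}g(V,V)$$ there holds $\lim_{\varepsilon\to0}V_\varepsilon=\hat V$.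
   Context: $\mathcal{R}(H)$ denotes the range of $H$. For a bounded linear operator $H$ with closed range on a Hilbert space, the Moore-Penrose pseudoinverse $H^+$ is the unique bounded linear operator satisfying $HH^+H=H$, $H^+HH^+=H^+$, with $HH^+$ and $H^+H$ self-adjoint with respect to $g$. The limit is in the norm induced by $g$, with $\varepsilon\to0$ through positive values. *)

(* Defs.v *)
From HB Require Import structures.
From mathcomp Require Import all_boot all_order all_algebra.
From mathcomp Require Import all_classical all_reals all_analysis.

Set Implicit Arguments.
Unset Strict Implicit.
Unset Printing Implicit Defensive.

Import Order.TTheory GRing.Theory Num.Theory.
Import numFieldNormedType.Exports.

Local Open Scope classical_set_scope.
Local Open Scope ring_scope.

(* A (real) Hilbert space (E, g) is a complete normed module E together with a
   positive definite symmetric bilinear form g, {dot E for idfun}, such that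
   the norm of E is the norm of g. *)
Definition norm_induced_by (R : realType) (E : completeNormedModType R)
    (g : {dot E for idfun}) : Prop :=
  forall x : E, `|x| = Num.sqrt (g x x).

Definition bounded_operator (R : realType) (E : completeNormedModType R)
    (A : {linear E -> E}) : Prop :=
  exists M : R, forall x : E, `|A x| <= M * `|x|.

Definition self_adjoint (R : realType) (E : completeNormedModType R)
    (g : {dot E for idfun}) (A : E -> E) : Prop :=
  forall x y : E, g (A x) y = g x (A y).

Definition positive_semidefinite (R : realType) (E : completeNormedModType R)
    (g : {dot E for idfun}) (A : E -> E) : Prop :=
  forall x : E, 0 <= g (A x) x.

Definition is_moore_penrose (R : realType) (E : completeNormedModType R)
    (g : {dot E for idfun}) (A P : {linear E -> E}) : Prop :=
  [/\ bounded_operator P,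
      A \o P \o A = A :> (E -> E),
      P \o A \o P = P :> (E -> E),
      self_adjoint g (A \o P) &
      self_adjoint g (P \o A)].

(* Chosen among the operators satisfying the Moore-Penrose conditions (there is
   exactly one when A is bounded with closed range); the null operator when
   there is none. *)
Definition moore_penrose (R : realType) (E : completeNormedModType R)
    (g : {dot E for idfun}) (A : {linear E -> E}) : {linear E -> E} :=
  xget (\0 : {linear E -> E}) [set P | is_moore_penrose g A P].

(* The set of all minimizers of J over C, so that argmin C J = [set x] says that
   x is the unique solution of the minimization problem. *)
Definition argmin (R : realType) (T : Type) (C : set T) (J : T -> R) : set T :=
  [set x | C x /\ forall y, C y -> J x <= J y].

(* Main.v *)
From HB Require Import structures.
Require Import Defs.
From mathcomp Require Import all_boot all_order all_algebra.
From mathcomp Require Import all_classical all_reals all_analysis.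
From mathcomp Require Import ring lra.

Set Implicit Arguments.
Unset Strict Implicit.
Unset Printing Implicit Defensive.

Import Order.TTheory GRing.Theory Num.Theory.
Import numFieldNormedType.Exports.

Local Open Scope classical_set_scope.
Local Open Scope ring_scope.

(** The first claim is Pythagoras: if [P] is a Moore-Penrose inverse of [H],
    then [P b] solves [H V = b], because [b] lies in the range of [H], and it
    is orthogonal to the kernel of [H], because [P H] is self-adjoint; any
    other solution differs from it by an element of the kernel, hence is longer.
    The substance is that a bounded Moore-Penrose inverse exists, and that the
    regularized solutions converge. Both come from one fact about Tikhonov
    regularization.

    Let [a] be a bounded, symmetric, positive semidefinite bilinear form, and
    let [V_eps] minimize [a (V - x0) (V - x0) + eps |V|^2], that is,
    [a (V_eps - x0) v + eps g(V_eps, v) = 0] for all [v].  Testing this equation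
    with [V_eps - x0] gives [|V_eps| <= |x0|]; comparing two parameters
    [d < eps] gives [|V_eps - V_d|^2 <= |V_d|^2 - |V_eps|^2].  So [|V_eps|^2]
    increases to a finite limit when [eps] decreases to [0], [V_eps] is Cauchy,
    and its limit [x] satisfies [a (x - x0) v = 0] for all [v] and is orthogonal
    to the radical of [a] (theorem [cvg_tikhonov]).

    With [a u v = g(H u, v)], for [H] self-adjoint and positive semidefinite,
    the functional is, up to scaling and a constant, the one of the
    linear-quadratic problem, and the limit is the solution of [H V = b]
    orthogonal to the kernel.

    With [a u v = g(H u, H v)] and [x0] a least squares solution for [y], which
    exists because the range of [H] is closed, the limit [P y] is the least
    squares solution orthogonal to the kernel.  It depends linearly on [y] and
    satisfies the four Moore-Penrose identities.  Its boundedness follows from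
    the uniform boundedness principle: for each [eps] the map [y |-> V_eps] is
    linear with norm at most [1 / (2 sqrt eps)], and these maps are pointwise
    bounded since [|V_eps| <= |x0|], where [x0] does not depend on [eps]. *)

(** * Symmetric bilinear forms *)

Section SymmetricForms.
Context {R : realType} {U : lmodType R}.
Implicit Types (a : {symmetric U}) (u v w x : U).

Lemma form_sym a u v : a u v = a v u.
Proof. by rewrite hermC expr0 mul1r. Qed.

Lemma formDl a u v w : a (u + v) w = a u w + a v w.
Proof. exact: linearDl. Qed.

Lemma formDr a u v w : a u (v + w) = a u v + a u w.
Proof. exact: linearDr. Qed.

Lemma formBl a u v w : a (u - v) w = a u w - a v w.
Proof. exact: linearBl. Qed.

Lemma formBr a u v w : a u (v - w) = a u v - a u w.
Proof. exact: linearBr. Qed.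

Lemma formZl a c u v : a (c *: u) v = c * a u v.
Proof. exact: linearZl_LR. Qed.

Lemma formZr a c u v : a u (c *: v) = c * a u v.
Proof. by rewrite form_sym formZl form_sym. Qed.

Lemma form_along_line a u v t :
  a (u + t *: v) (u + t *: v) = a u u + 2 * t * a u v + t ^+ 2 * a v v.
Proof. by rewrite formDl !formDr !formZl !formZr (form_sym a v u); ring. Qed.

(** The parallelogram identity seen from a base point [x]: it measures the
    strong convexity of [u |-> a (u - x) (u - x)]. *)
Lemma form_parallelogram a x u v :
  a (u - x) (u - x) + a (v - x) (v - x)
    - 2 * a (2^-1 *: (u + v) - x) (2^-1 *: (u + v) - x)
  = 2^-1 * a (u - v) (u - v).
Proof.
have -> : 2^-1 *: (u + v) - x = 2^-1 *: ((u - x) + (v - x)).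
  rewrite addrACA -opprD scalerBr -mulr2n -(scaler_nat 2 x) scalerA.
  by rewrite mulVf ?scale1r.
have -> : u - v = (u - x) - (v - x) by rewrite opprB addrA subrK.
move: (u - x) (v - x) => p q.
by rewrite formZl formZr formBl !formBr formDl !formDr (form_sym a q p); field.
Qed.

Section SymmetricFormOf.
Context (f : U -> U -> R) (f_scalar : forall v, scalar (f^~ v)).
Context (f_sym : forall u v, f u v = f v u).

Let f_bilinear : bilinear_for *%R *%R f.
Proof. by split=> // u c x y; rewrite f_sym f_scalar /= ![f _ u]f_sym. Qed.

Let f_hermitian u v : f u v = (-1) ^+ false * f v u.
Proof. by rewrite expr0 mul1r. Qed.

Definition symmetric_form_of : {symmetric U} :=
  HB.pack f (bilinear_isBilinear.Build R U U R _ _ f f_bilinear)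
    (isHermitianSesquilinear.Build R U false idfun f f_hermitian).

End SymmetricFormOf.
End SymmetricForms.

(** * Minimization *)

(** The first order condition at a minimizer of a quadratic function of one
    real variable; [p] will be a directional derivative. *)
Lemma linear_coef_eq0 (R : realType) (p q : R) :
  (forall t, 0 <= 2 * t * p + t ^+ 2 * q) -> p = 0.
Proof.
move=> nonneg; apply/eqP; apply: contraT => p0.
have p2 : 0 < p ^+ 2 by rewrite lt_def sqrf_eq0 p0 sqr_ge0.
have q1 : 0 < `|q| + 1 by rewrite ltr_wpDl.
(* at this t the linear term outweighs the quadratic one *)
have := nonneg (- p / (`|q| + 1)).
have -> : 2 * (- p / (`|q| + 1)) * p + (- p / (`|q| + 1)) ^+ 2 * q
   = (p / (`|q| + 1)) ^+ 2 * (q - 2 * (`|q| + 1)).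
  by field; rewrite gt_eqF.
have : 0 < (p / (`|q| + 1)) ^+ 2.
  by rewrite expr_div_n divr_gt0// exprn_gt0.
by have := ler_norm q; nra.
Qed.

Lemma argmin_affine (R : realType) (T : Type) (C : set T) (J K : T -> R)
    (c d : R) :
  0 < c -> (forall x, J x = c * K x - d) -> argmin C J = argmin C K.
Proof.
move=> c0 JK; apply/seteqP; split=> x [Cx xmin]; split=> // y Cy;
  by have := xmin _ Cy; rewrite !JK lerD2r ler_pM2l.
Qed.

(** Completeness produces the minimizer: by midpoint strong convexity, the set
    of points at which [J] exceeds its infimum by less than [e] has diameter
    [O(sqrt e)], so these sets generate a Cauchy filter. *)
Lemma argmin_strongly_convex (R : realType) (E : completeNormedModType R)
    (C : set E) (J : E -> R) (c : R) :
  C !=set0 -> closed C ->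
  (forall u v, C u -> C v -> C (2^-1 *: (u + v))) ->
  continuous J -> (forall u, 0 <= J u) -> 0 < c ->
  (forall u v, c * `|u - v| ^+ 2 <= J u + J v - 2 * J (2^-1 *: (u + v))) ->
  exists x, argmin C J = [set x].
Proof.
move=> [y0 Cy0] Ccl Cmid Jcont J0 c0 Jconv.
have uniq x y : argmin C J x -> argmin C J y -> x = y.
  move=> [Cx xmin] [Cy ymin]; apply/eqP; rewrite -subr_eq0 -normr_eq0.
  rewrite -sqrf_eq0; apply/eqP/le_anti; rewrite sqr_ge0 andbT.
  have := Jconv x y; have := xmin _ (Cmid _ _ Cx Cy).
  have := ymin _ (Cmid _ _ Cx Cy); nra.
suff [x xmin] : exists x, argmin C J x.
  by exists x; apply/seteqP; split=> [y ymin|y -> //]; exact: uniq.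
pose m := inf (J @` C).
have JCinf : has_inf (J @` C).
  by split; [exists (J y0), y0 | exists 0 => _ [u _ <-]].
have m_le u : C u -> m <= J u.
  by move=> Cu; apply: ge_inf; [exact: JCinf.2 | exists u].
pose S e := C `&` [set u | J u < m + e].
have SN0 e : 0 < e -> S e !=set0.
  by move=> e0; have [_ [u Cu <-] Ju] := inf_adherent e0 JCinf; exists u.
pose F := filter_from [set e : R | 0 < e] S.
have FF : ProperFilter F.
  apply: filter_from_proper SN0; apply: filter_from_filter; first by exists 1.
  move=> i j /= i0 j0; exists (Num.min i j) => /=.
    by rewrite lt_min i0.
  move=> u [Cu]; rewrite /S/= => Ju.
  by split; split=> //=; apply: (lt_le_trans Ju);
    rewrite lerD2l ge_min lexx ?orbT.
have FS e : 0 < e -> F (S e) by exists e.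
have Fc : cauchy F.
  apply: cauchy_exP => e e0.
  have e'0 : 0 < c * e ^+ 2 / 2 by rewrite divr_gt0 ?mulr_gt0 ?exprn_gt0.
  have [x [Cx Jx]] := SN0 _ e'0; exists x.
  apply: filterS (FS _ e'0) => y [Cy Jy].
  rewrite -ball_normE /ball_/= -(@ltr_pXn2r _ 2) ?nnegrE ?(ltW e0)//.
  have := Jconv x y; have := m_le _ (Cmid _ _ Cx Cy).
  rewrite /= in Jx Jy; move=> h1 h2; rewrite -(ltr_pM2l c0); lra.
have /cauchy_cvgP/cvg_ex[x Fx] := Fc.
exists x; split.
  apply: (@closed_cvg _ _ F FF id C Ccl _ x Fx).
  by apply: filterS (FS 1 ltr01) => u [].
move=> y /m_le; apply: le_trans; apply/ler_addgt0Pr => e e0.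
have := @closed_cvg _ _ F FF J [set r | r <= m + e] _ _ (J x).
apply; first exact: closed_le.
- by apply: filterS (FS _ e0) => u [_ /ltW].
- by apply: (cvg_comp id J Fx); exact: Jcont.
Qed.

(** * Bounded forms and the inner product *)

Definition bounded_form (R : realType) (E : completeNormedModType R)
    (a : E -> E -> R) : Prop :=
  exists M, forall u v, `|a u v| <= M * `|u| * `|v|.

Lemma cvg_form (R : realType) (E : completeNormedModType R)
    (a : {symmetric E}) (T : Type) (F : set_system T)
    (FF : ProperFilter F) (u v : T -> E) (x y : E) :
  bounded_form a -> u @ F --> x -> v @ F --> y ->
  a (u t) (v t) @[t --> F] --> a x y.
Proof.
move=> [M aM] ux vy; apply/cvgrPdist_lt => e e0.
suff : `|M| * `|x - u t| * `|v t| + `|M| * `|x| * `|y - v t| @[t --> F]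
       --> (0 : R).
  move=> /cvgrPdist_lt/(_ e e0); apply: filterS => t.
  rewrite sub0r normrN; apply: le_lt_trans.
  have -> : a x y - a (u t) (v t) = a (x - u t) (v t) + a x (y - v t).
    by rewrite formBl formBr; ring.
  apply: le_trans (ler_norm _); apply: le_trans (ler_normD _ _) _.
  by apply: lerD; apply: le_trans (aM _ _) _; rewrite !ler_wpM2r// ler_norm.
have -> : (0 : R) = `|M| * `|x - x| * `|y| + `|M| * `|x| * `|y - y|.
  by rewrite !subrr normr0 !mulr0 mul0r addr0.
apply: cvgD; apply: cvgM.
- apply: cvgM; first exact: cvg_cst.
  by apply: cvg_norm; apply: cvgB ux; exact: cvg_cst.
- exact: cvg_norm.
- exact: cvg_cst.
- by apply: cvg_norm; apply: cvgB vy; exact: cvg_cst.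
Qed.

Section InnerProduct.
Context {R : realType} {E : completeNormedModType R} (g : {dot E for idfun}).

(* The identities for forms are restated for [g] applied as a positive definite
   form: its coercion to a symmetric form would otherwise surface in goals. *)

Lemma dot_sym u v : g u v = g v u. Proof. exact: form_sym. Qed.

Lemma dotDl u v w : g (u + v) w = g u w + g v w.
Proof. exact: formDl. Qed.

Lemma dotBl u v w : g (u - v) w = g u w - g v w.
Proof. exact: formBl. Qed.

Lemma dotBr u v w : g u (v - w) = g u v - g u w.
Proof. exact: formBr. Qed.

Lemma dotZl c u v : g (c *: u) v = c * g u v.
Proof. exact: formZl. Qed.

Lemma dotZr c u v : g u (c *: v) = c * g u v.
Proof. exact: formZr. Qed.

Lemma dot_along_line u v t :
  g (u + t *: v) (u + t *: v) = g u u + 2 * t * g u v + t ^+ 2 * g v v.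
Proof. exact: form_along_line. Qed.

Lemma dot_parallelogram x u v :
  g (u - x) (u - x) + g (v - x) (v - x)
    - 2 * g (2^-1 *: (u + v) - x) (2^-1 *: (u + v) - x)
  = 2^-1 * g (u - v) (u - v).
Proof. exact: form_parallelogram. Qed.

Lemma dot_ge0 u : 0 <= g u u.
Proof. by have [->|/neq0_dnorm_gt0/ltW//] := eqVneq u 0; rewrite linear0l. Qed.

Lemma dot_eq0 u : g u u = 0 -> u = 0.
Proof.
move=> u0; apply/eqP; apply: contraT => /(neq0_dnorm_gt0 (s := g)).
by rewrite u0 ltxx.
Qed.

Lemma dot_sub_eq0 u v : g (u - v) (u - v) = 0 -> u = v.
Proof. by move=> /dot_eq0/eqP; rewrite subr_eq0 => /eqP. Qed.

Hypothesis hg : norm_induced_by g.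

Lemma dot_norm u : g u u = `|u| ^+ 2.
Proof. by rewrite hg sqr_sqrtr// dot_ge0. Qed.

Lemma cauchy_schwarz u v : `|g u v| <= `|u| * `|v|.
Proof.
rewrite -(@ler_pXn2r _ 2) ?nnegrE ?mulr_ge0// real_normK ?num_real// exprMn.
rewrite -!dot_norm.
have [->|v0] := eqVneq v 0; first by rewrite linear0r !linear0l expr0n mulr0.
have vv0 := neq0_dnorm_gt0 (s := g) _ v0.
(* [g v v] times the component of [u] orthogonal to [v] *)
have := dot_ge0 (g v v *: u - g u v *: v).
rewrite dotBl !dotBr !dotZl !dotZr (dot_sym v u) => h.
by rewrite -subr_ge0 -(pmulr_rge0 _ vv0); lra.
Qed.

Lemma bounded_dot : bounded_form g.
Proof. by exists 1 => u v; rewrite mul1r cauchy_schwarz. Qed.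

End InnerProduct.

(** * Tikhonov regularization *)

Section Tikhonov.
Context {R : realType} {E : completeNormedModType R} (g : {dot E for idfun}).
Hypothesis hg : norm_induced_by g.
Context (a : {symmetric E}).
Hypotheses (a_ge0 : forall u, 0 <= a u u) (a_bounded : bounded_form a).
Implicit Types (eps : R) (x u v w : E).

Definition tikhonov eps x0 V : R := a (V - x0) (V - x0) + eps * g V V.

(** The Euler-Lagrange equation of [tikhonov eps x0]. *)
Definition tikhonov_eq eps x0 V : Prop :=
  forall v, a (V - x0) v + eps * g V v = 0.

Lemma tikhonov_eqB eps eps' x0 u w v :
  tikhonov_eq eps x0 u -> tikhonov_eq eps' x0 w ->
  a (u - w) v + eps * g u v - eps' * g w v = 0.
Proof. by move=> /(_ v) + /(_ v); rewrite !formBl; lra. Qed.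

Lemma tikhonov_eq_unique eps x0 u w : 0 < eps ->
  tikhonov_eq eps x0 u -> tikhonov_eq eps x0 w -> u = w.
Proof.
move=> eps0 hu hw; apply: (dot_sub_eq0 (g := g)).
have := tikhonov_eqB (u - w) hu hw; rewrite -addrA -mulrBr -dotBl => h.
by have := a_ge0 (u - w); have := dot_ge0 g (u - w); nra.
Qed.

Lemma argmin_tikhonov eps x0 : 0 < eps -> exists x,
  argmin [set: E] (tikhonov eps x0) = [set x] /\ tikhonov_eq eps x0 x.
Proof.
move=> eps0.
have [|||||||x xmin] :=
  @argmin_strongly_convex R E setT (tikhonov eps x0) (eps / 2).
- by exists 0.
- exact: closedT.
- by [].
- move=> u; have ux0 : (u' - x0) @[u' --> u] --> u - x0.
    by apply: cvgB; [exact: cvg_id|exact: cvg_cst].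
  apply: cvgD; first exact: (cvg_form _ a_bounded ux0 ux0).
  apply: cvgM; first exact: cvg_cst.
  exact: (cvg_form _ (bounded_dot hg) cvg_id cvg_id).
- by move=> u; rewrite addr_ge0// mulr_ge0 ?dot_ge0// ltW.
- by rewrite divr_gt0.
- move=> u v; rewrite /tikhonov -(dot_norm hg (u - v)).
  have := form_parallelogram a x0 u v.
  have := dot_parallelogram g 0 u v; rewrite !subr0.
  by have := a_ge0 (u - v); nra.
exists x; split=> // v.
have [_ {}xmin] : argmin [set: E] (tikhonov eps x0) x by rewrite xmin.
apply: (linear_coef_eq0 (q := a v v + eps * g v v)) => t.
have := xmin (x + t *: v) I; rewrite /tikhonov (addrAC x).
by rewrite form_along_line dot_along_line; lra.
Qed.

Lemma tikhonov_eq_norm eps x0 x : 0 < eps ->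
  tikhonov_eq eps x0 x -> `|x| <= `|x0|.
Proof.
move=> eps0 /(_ (x - x0)); rewrite dotBr => h.
have {h} : g x x <= g x x0 by have := a_ge0 (x - x0); nra.
move=> /le_trans/(_ (ler_norm _))/le_trans/(_ (cauchy_schwarz hg _ _)).
have [->|x_neq0] := eqVneq x 0; first by rewrite normr0.
by rewrite (dot_norm hg) expr2 ler_pM2l ?normr_gt0.
Qed.

(** Test the difference of the two equations with [u - w]: what remains says
    that [g u (u - w) <= 0], the smaller parameter giving the longer vector. *)
Lemma tikhonov_eq_dist eps eps' x0 u w : 0 < eps' -> eps' < eps ->
  tikhonov_eq eps x0 u -> tikhonov_eq eps' x0 w ->
  `|u - w| ^+ 2 <= `|w| ^+ 2 - `|u| ^+ 2.
Proof.
move=> eps0 lt_eps hu hw; have := tikhonov_eqB (u - w) hu hw.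
have := a_ge0 (u - w); have := dot_ge0 g (u - w).
by rewrite -!(dot_norm hg) !dotBl !dotBr (dot_sym g w u); nra.
Qed.

(** The limit is the point of [x0 + rad a] orthogonal to [rad a], where
    [rad a] is the radical of the form. *)
Theorem cvg_tikhonov x0 (V : R -> E) :
  (forall eps, 0 < eps -> tikhonov_eq eps x0 (V eps)) ->
  exists x, [/\ V eps @[eps --> 0^'+] --> x,
    forall v, a (x - x0) v = 0 &
    forall k, (forall v, a k v = 0) -> g x k = 0].
Proof.
move=> hV.
pose N := [set `|V eps| ^+ 2 | eps in [set eps : R | 0 < eps]].
have Nsup : has_sup N.
  split; first by exists (`|V 1| ^+ 2); exists 1 => /=.
  exists (`|x0| ^+ 2) => _ [eps /= eps0 <-]; rewrite lerXn2r ?nnegrE//.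
  exact: tikhonov_eq_norm (hV _ eps0).
have Vcauchy : cauchy (V eps @[eps --> 0^'+]).
  apply: cauchy_exP => e e0.
  have [_ [d /= d0 <-] dN] := sup_adherent (exprn_gt0 2 e0) Nsup.
  exists (V d); rewrite nbhs_simpl.
  near=> eps.
  have eps0 : 0 < eps by near: eps; exact: nbhs_right_gt.
  have epsd : eps < d by near: eps; exact: nbhs_right_lt.
  rewrite -ball_normE /ball_/= -(@ltr_pXn2r _ 2) ?nnegrE ?(ltW e0)//.
  apply: le_lt_trans (tikhonov_eq_dist eps0 epsd (hV _ d0) (hV _ eps0)) _.
  have : `|V eps| ^+ 2 <= sup N.
    by apply: ub_le_sup; [exact: Nsup.2|exists eps].
  by move=> ?; lra.
have /cauchy_cvgP/cvg_ex[x Vx] := Vcauchy.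
have gV v : g (V eps) v @[eps --> 0^'+] --> g x v.
  by apply: (cvg_form _ (bounded_dot hg) Vx); exact: cvg_cst.
exists x; split=> // [v|k ak].
- have lim : a (V eps - x0) v + eps * g (V eps) v @[eps --> 0^'+]
             --> a (x - x0) v + 0 * g x v.
    apply: cvgD.
      by apply: cvg_form => //; [apply: cvgB => //; exact: cvg_cst|
                                 exact: cvg_cst].
    by apply: cvgM (gV v); exact: cvg_within.
  have := closed_cvg (fun r : R => r = 0) _ _ _ lim; rewrite mul0r addr0.
  by apply; [exact: closed_eq|near=> eps; apply: hV].
- have := closed_cvg (fun r : R => r = 0) _ _ _ (gV k); apply.
    exact: closed_eq.
  near=> eps; have eps0 : 0 < eps by near: eps; exact: nbhs_right_gt.
  have := hV _ eps0 k; rewrite form_sym ak add0r => /eqP.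
  by rewrite mulf_eq0 gt_eqF//= => /eqP.
Unshelve. all: by end_near. Qed.

End Tikhonov.

(** * Existence of the Moore-Penrose inverse *)

Section PseudoInverse.
Context {R : realType} {E : completeNormedModType R} (g : {dot E for idfun}).
Hypothesis hg : norm_induced_by g.
Context (A : {linear E -> E}).
Implicit Types (eps c : R) (x y u v : E).

Let normal_form_scalar v : scalar (fun u => g (A u) (A v)).
Proof. by move=> c x y; rewrite linearP/= dotDl dotZl. Qed.

(** The form of the normal operator [A^* A], with [A^*] the adjoint of [A]. *)
Definition normal_form : {symmetric E} :=
  symmetric_form_of normal_form_scalar (fun u v => dot_sym g (A u) (A v)).

Lemma normal_formE u v : normal_form u v = g (A u) (A v).
Proof. by []. Qed.

Lemma normal_form_ge0 u : 0 <= normal_form u u.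
Proof. exact: dot_ge0. Qed.

Lemma bounded_normal_form : bounded_operator A -> bounded_form normal_form.
Proof.
move=> [M AM]; exists (M ^+ 2) => u v; rewrite normal_formE.
apply: le_trans (cauchy_schwarz hg _ _) _.
have -> : M ^+ 2 * `|u| * `|v| = (M * `|u|) * (M * `|v|) by ring.
by rewrite ler_pM.
Qed.

(** The weak form of the normal equation [A^* A x = A^* y]. *)
Definition least_squares_eq y x : Prop := forall v, g (A x - y) (A v) = 0.

Definition min_norm_least_squares y x : Prop :=
  least_squares_eq y x /\ forall k, A k = 0 -> g x k = 0.

(** The weak form of [(A^* A + eps) x = A^* y]. *)
Definition damped_normal_eq eps y x : Prop :=
  forall v, g (A x - y) (A v) + eps * g x v = 0.

(** The least squares solution is the nearest point of the range of [A], which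
    is closed, hence complete. *)
Lemma least_squares_exists : closed (range A) ->
  forall y, exists x, least_squares_eq y x.
Proof.
move=> Acl y; pose J z := g (z - y) (z - y).
have [||u v [u' _ <-] [v' _ <-]||||u v|z zmin] :=
  @argmin_strongly_convex R E (range A) J 2^-1.
- by exists (A 0), 0.
- exact: Acl.
- by exists (2^-1 *: (u' + v')) => //; rewrite linearZ linearD.
- move=> z; have zy : (z' - y) @[z' --> z] --> z - y.
    by apply: cvgB; [exact: cvg_id|exact: cvg_cst].
  exact: (cvg_form _ (bounded_dot hg) zy zy).
- by move=> u; exact: dot_ge0.
- by rewrite invr_gt0.
- by rewrite /J dot_parallelogram (dot_norm hg (u - v)).
have [[x _ xz] {}zmin] : argmin (range A) J z by rewrite zmin.
exists x => v; apply: (linear_coef_eq0 (q := g (A v) (A v))) => t.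
have Cz : range A (z + t *: A v).
  by exists (x + t *: v) => //; rewrite linearD linearZ xz.
by have := zmin _ Cz; rewrite xz /J (addrAC z) dot_along_line; lra.
Qed.

Lemma damped_normal_eqP eps y x0 x : least_squares_eq y x0 ->
  damped_normal_eq eps y x <-> tikhonov_eq g normal_form eps x0 x.
Proof.
move=> hx0.
have eqv v : g (A x - y) (A v) = normal_form (x - x0) v.
  by have := hx0 v; rewrite normal_formE linearB !dotBl; lra.
by split=> h v; [rewrite -eqv | rewrite eqv].
Qed.

Lemma damped_normal_eq_linear eps c y y' x x' :
  damped_normal_eq eps y x -> damped_normal_eq eps y' x' ->
  damped_normal_eq eps (c *: y + y') (c *: x + x').
Proof.
move=> h h' v; have := congr1 ( *%R c) (h v); have := h' v.
by rewrite linearP !dotBl !dotDl !dotZl; lra.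
Qed.

(** Test the equation with [x] and bound [g y (A x)] by
    [|A x|^2 + |y|^2 / 4]. *)
Lemma damped_normal_eq_norm eps y x : 0 < eps ->
  damped_normal_eq eps y x -> `|x| <= (2 * Num.sqrt eps)^-1 * `|y|.
Proof.
move=> eps0 /(_ x); rewrite dotBl !(dot_norm hg) => h.
have s0 : 0 < Num.sqrt eps by rewrite sqrtr_gt0.
rewrite ler_pdivlMl ?mulr_gt0// -(@ler_pXn2r _ 2) ?nnegrE;
  rewrite ?mulr_ge0 ?(ltW s0)//.
rewrite !exprMn sqr_sqrtr ?(ltW eps0)//.
have := le_trans (ler_norm _) (cauchy_schwarz hg y (A x)).
by have := sqr_ge0 (2 * `|A x| - `|y|); nra.
Qed.

Lemma min_norm_least_squares_unique y x x' :
  min_norm_least_squares y x -> min_norm_least_squares y x' -> x = x'.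
Proof.
move=> [h hk] [h' hk']; apply: (dot_sub_eq0 (g := g)).
have Ad : A (x - x') = 0.
  apply: (dot_eq0 (g := g)); have := h (x - x'); have := h' (x - x').
  by rewrite linearB !dotBl; lra.
by rewrite dotBl hk// hk'// subrr.
Qed.

Lemma min_norm_least_squares_linear c y y' x x' :
  min_norm_least_squares y x -> min_norm_least_squares y' x' ->
  min_norm_least_squares (c *: y + y') (c *: x + x').
Proof.
move=> [h hk] [h' hk']; split=> [v|k Ak].
  have := congr1 ( *%R c) (h v); have := h' v.
  by rewrite linearP !dotBl !dotDl !dotZl; lra.
by rewrite dotDl dotZl hk// hk'// mulr0 addr0.
Qed.

Section ClosedRange.
Hypotheses (A_bounded : bounded_operator A) (A_closed : closed (range A)).

Lemma damped_normal_eq_exists eps y :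
  0 < eps -> exists x, damped_normal_eq eps y x.
Proof.
move=> eps0; have [x0 hx0] := least_squares_exists A_closed y.
have [x [_ hx]] :=
  argmin_tikhonov hg normal_form_ge0 (bounded_normal_form A_bounded) x0 eps0.
by exists x; apply/(damped_normal_eqP _ _ hx0).
Qed.

Lemma cvg_damped_normal_eq y (V : R -> E) :
  (forall eps, 0 < eps -> damped_normal_eq eps y (V eps)) ->
  exists x, min_norm_least_squares y x /\ V eps @[eps --> 0^'+] --> x.
Proof.
move=> hV; have [x0 hx0] := least_squares_exists A_closed y.
have [|x [Vx hx hk]] := cvg_tikhonov hg normal_form_ge0
    (bounded_normal_form A_bounded) (x0 := x0) (V := V).
  by move=> eps eps0; apply/(damped_normal_eqP _ _ hx0); exact: hV.
exists x; split=> //; split=> [v|k Ak].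
  by have := hx0 v; have := hx v; rewrite normal_formE linearB !dotBl; lra.
by apply: hk => v; rewrite normal_formE Ak linear0l.
Qed.

(** The uniform boundedness principle turns the bound by a least squares
    solution, which is uniform in [eps] but not in [y], into one uniform in
    both. *)
Lemma damped_normal_eq_uniform_bound : exists M, forall eps (f : E -> E),
  0 < eps -> (forall y, damped_normal_eq eps y (f y)) ->
  forall y, `|y| <= 1 -> `|f y| <= M.
Proof.
pose F := [set f : E -> E |
  exists2 eps : R, 0 < eps & forall y, damped_normal_eq eps y (f y)].
suff /(_ 1)[M FM] : uniform_bounded F.
  by exists M => eps f eps0 hf; apply: FM; exists eps.
have ls := least_squares_exists A_closed.
apply: Banach_Steinhauss => [f [eps eps0 hf]|y]; last first.
  have [x0 hx0] := ls y.
  exists `|x0| => f [eps eps0 hf].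
  apply: (tikhonov_eq_norm hg normal_form_ge0 eps0).
  by apply/(damped_normal_eqP _ _ hx0).
split=> [r|c y y'].
  exists ((2 * Num.sqrt eps)^-1 * r) => y yr.
  apply: le_trans (damped_normal_eq_norm eps0 (hf y)) _.
  by rewrite ler_wpM2l// invr_ge0 mulr_ge0// sqrtr_ge0.
have [x0 hx0] := ls (c *: y + y').
apply: (tikhonov_eq_unique normal_form_ge0 eps0 (x0 := x0)).
  exact/(damped_normal_eqP _ _ hx0).
by apply/(damped_normal_eqP _ _ hx0); exact: damped_normal_eq_linear.
Qed.

Lemma bounded_min_norm_least_squares : exists P : {linear E -> E},
  bounded_operator P /\ forall y, min_norm_least_squares y (P y).
Proof.
have damped (p : R * E) : exists x, 0 < p.1 -> damped_normal_eq p.1 p.2 x.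
  case: p => eps y /=; have [eps0|] := ltP 0 eps; last by exists 0.
  by have [x hx] := damped_normal_eq_exists y eps0; exists x.
have [S hS] := choice damped.
have /choice[P hP] : forall y, exists x, min_norm_least_squares y x /\
    S (eps, y) @[eps --> 0^'+] --> x.
  by move=> y; apply: cvg_damped_normal_eq => eps eps0; exact: (hS (eps, y)).
have P_linear : linear P.
  move=> c y y'; apply: (min_norm_least_squares_unique (hP _).1).
  exact: min_norm_least_squares_linear (hP y).1 (hP y').1.
have [M SM] := damped_normal_eq_uniform_bound.
have PM y : `|y| <= 1 -> `|P y| <= M.
  move=> y1.
  have SP : `|S (eps, y)| @[eps --> 0^'+] --> `|P y|.
    by apply: cvg_norm; exact: (hP y).2.
  have := closed_cvg (fun r : R => r <= M) _ _ _ SP.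
  apply; first exact: closed_le.
  near=> eps; have eps0 : 0 < eps by near: eps; exact: nbhs_right_gt.
  by apply: (SM eps (fun z => S (eps, z))) => // z; exact: (hS (eps, z)).
pose P' : {linear E -> E} :=
  HB.pack P (GRing.isLinear.Build _ _ _ _ P P_linear).
have PZ c y : P (c *: y) = c *: P y := linearZ_LR P' c y.
exists P'; split=> [|y]; last exact: (hP y).1.
exists M => y; have [->|y0] := eqVneq y 0.
  by rewrite linear0 normr0 mulr0.
have ny : 0 < `|y| by rewrite normr_gt0.
have := PM (`|y|^-1 *: y); rewrite PZ !normrZ normfV normr_id.
by rewrite mulVf ?gt_eqF// lexx mulrC ler_pdivrMr// => ->.
Unshelve. all: by end_near. Qed.

End ClosedRange.

(** [A P] is the orthogonal projection onto the range of [A], and [P A] the one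
    onto the orthogonal complement of its kernel. *)
Lemma moore_penrose_of_least_squares (P : {linear E -> E}) :
  bounded_operator P -> (forall y, min_norm_least_squares y (P y)) ->
  is_moore_penrose g A P.
Proof.
move=> P_bounded hP.
have AP y v : g (A (P y)) (A v) = g y (A v).
  by have := (hP y).1 v; rewrite dotBl; lra.
have APA x : A (P (A x)) = A x.
  by apply: (dot_sub_eq0 (g := g)); rewrite dotBl -(linearB A) AP subrr.
have perp x k : A k = 0 -> g (P x) k = 0 := (hP x).2 k.
have PA x w : g (P (A x)) (P (A w)) = g (P (A x)) w.
  apply/eqP; rewrite -subr_eq0 -dotBr; apply/eqP/perp.
  by rewrite linearB APA subrr.
split => //.
- by apply/funext => x /=; exact: APA.
- apply/funext => y /=; apply: (min_norm_least_squares_unique (hP _)).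
  by split; [move=> v; rewrite subrr linear0l | exact: (hP y).2].
- by move=> y z /=; rewrite -(AP y) (dot_sym g _ z) -(AP z) dot_sym.
- by move=> y z /=; rewrite -PA dot_sym PA dot_sym.
Qed.

End PseudoInverse.

Theorem moore_penrose_exists (R : realType) (E : completeNormedModType R)
    (g : {dot E for idfun}) (A : {linear E -> E}) : norm_induced_by g ->
  bounded_operator A -> closed (range A) -> exists P, is_moore_penrose g A P.
Proof.
move=> hg Abd Acl.
have [P [P_bounded hP]] := bounded_min_norm_least_squares hg Abd Acl.
by exists P; exact: moore_penrose_of_least_squares.
Qed.

Lemma moore_penrose_min_norm (R : realType) (E : completeNormedModType R)
    (g : {dot E for idfun}) (A P : {linear E -> E}) (b : E) :
  is_moore_penrose g A P -> range A b ->
  A (P b) = b /\ forall k, A k = 0 -> g (P b) k = 0.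
Proof.
move=> [_ APA _ _ PAsym] [x _ <-]; split; first exact: (congr1 (@^~ x) APA).
by move=> k Ak; rewrite -[P (A x)]/((P \o A) x) PAsym /= Ak linear0 linear0r.
Qed.

(** * The energy form of a self-adjoint operator *)

Section SelfAdjoint.
Context {R : realType} {E : completeNormedModType R} (g : {dot E for idfun}).
Context (A : {linear E -> E}) (A_sa : self_adjoint g A).

Let energy_form_scalar v : scalar (fun u => g (A u) v).
Proof. by move=> c x y; rewrite linearP/= dotDl dotZl. Qed.

Let energy_form_sym u v : g (A u) v = g (A v) u.
Proof. by rewrite A_sa dot_sym. Qed.

Definition energy_form : {symmetric E} :=
  symmetric_form_of energy_form_scalar energy_form_sym.

Lemma energy_formE u v : energy_form u v = g (A u) v.
Proof. by []. Qed.

Lemma bounded_energy_form :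
  norm_induced_by g -> bounded_operator A -> bounded_form energy_form.
Proof.
move=> hg [M AM]; exists M => u v; rewrite energy_formE.
by apply: le_trans (cauchy_schwarz hg _ _) _; rewrite ler_wpM2r.
Qed.

(** Completing the square: since [b = A x0], the objective of the
    linear-quadratic problem is half the Tikhonov functional centered at [x0],
    up to a constant. *)
Lemma energy_tikhonov (x0 b : E) (eps : R) (V : E) : A x0 = b ->
  1 / 2 * g (A V) V - g b V + eps / 2 * g V V =
  2^-1 * tikhonov g energy_form eps x0 V - 2^-1 * g b x0.
Proof.
move=> Ax0; rewrite /tikhonov energy_formE (linearB A) Ax0 dotBl !dotBr.
by rewrite (A_sa V x0) Ax0 (dot_sym _ V b); field.
Qed.

End SelfAdjoint.

(** * The theorem *)

Theorem theorem3p3 (R : realType) (E : completeNormedModType R)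
    (g : {dot E for idfun}) (hg : norm_induced_by g)
    (H : {linear E -> E}) (Hbounded : bounded_operator H)
    (Hclosed : closed (range H)) (b : E) (hb : range H b) :
  let Vhat := moore_penrose g H b in
  argmin [set V | H V = b] (fun V => g V V) = [set Vhat] /\
  (self_adjoint g H -> positive_semidefinite g H ->
   exists Veps : R -> E,
     (forall eps : R, 0 < eps ->
        argmin [set: E]
          (fun V => 1 / 2 * g (H V) V - g b V + eps / 2 * g V V)
        = [set Veps eps]) /\
     Veps eps @[eps --> 0^'+] --> Vhat).
Proof.
move=> Vhat.
have Hmp : is_moore_penrose g H (moore_penrose g H).
  have [P hP] := moore_penrose_exists hg Hbounded Hclosed.
  exact: (@xgetI _ _ _ P hP).
have [HVhat Vhat_perp] : H Vhat = b /\ forall k, H k = 0 -> g Vhat k = 0.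
  exact: moore_penrose_min_norm.
split.
  have pythagoras V : H V = b -> g V V = g Vhat Vhat + g (V - Vhat) (V - Vhat).
    move=> HV; have : g Vhat (V - Vhat) = 0.
      by apply: Vhat_perp; rewrite linearB HV HVhat subrr.
    by rewrite dotBl !dotBr (dot_sym _ V Vhat); lra.
  apply/seteqP; split=> [V [HV Vmin]|_ ->].
    apply: (dot_sub_eq0 (g := g)).
    have := Vmin _ HVhat; rewrite pythagoras// gerDl => le0.
    by apply/le_anti; rewrite le0 dot_ge0.
  by split=> // V HV; rewrite (pythagoras V HV) lerDl dot_ge0.
move=> Hsa Hpsd.
pose a := energy_form Hsa.
have a_ge0 u : 0 <= a u u by exact: Hpsd.
have a_bounded : bounded_form a by exact: bounded_energy_form.
have min_exists (eps : R) : exists V, 0 < eps ->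
    argmin [set: E] (tikhonov g a eps Vhat) = [set V] /\
    tikhonov_eq g a eps Vhat V.
  have [eps0|] := ltP 0 eps; last by exists 0.
  by have [V hV] := argmin_tikhonov hg a_ge0 a_bounded Vhat eps0; exists V.
have [Veps hVeps] := choice min_exists.
exists Veps; split=> [eps eps0|].
  rewrite -(hVeps _ eps0).1.
  by apply: argmin_affine (energy_tikhonov Hsa eps ^~ HVhat); rewrite invr_gt0.
have [|x [Vx ax xperp]] :=
    cvg_tikhonov hg a_ge0 a_bounded (x0 := Vhat) (V := Veps).
  by move=> eps /hVeps[].
suff <- : x = Vhat by [].
have Hd : H (x - Vhat) = 0 by apply: (dot_eq0 (g := g)); exact: ax.
apply: (dot_sub_eq0 (g := g)).
rewrite dotBl Vhat_perp// subr0; apply: xperp => v.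
by rewrite energy_formE Hd linear0l.
Qed.
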